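(* Assume that there is a proper class ${\sf K}$ of infinite cardinal numbers such that for each $\lambda\in{\sf K}$ there is a cardinal number $f(\lambda)$ such that ${\sf I}(\lambda,f(\lambda))$ holds. Then for each cardinal $\lambda\ge 2$ there exists a cardinal $\kappa\ge 1$ such that ${\sf D}(\lambda,\kappa)$ holds.
   Context: Ideals: an ideal on a set $S$ is a nonempty family $J\subseteq\mathcal{P}(S)$ closed under subsets and under unions of two members; it is proper if $J\ne\mathcal{P}(S)$ and free if $\bigcup J=S$; $J^+=\mathcal{P}(S)\setminus J$. It is $\lambda^+$-complete if the union of at most $\lambda$ members of $J$ belongs to $J$. For infinite cardinals $\kappa$ and $\lambda$, ${\sf I}(\lambda,\kappa)$ is the statement: there is a free proper ideal $J$ on $\kappa$ such that (1) $J$ is $\lambda^+$-complete; (2) each $X\in J^+$ has a partition into $\lambda$ disjoint sets, each in $J^+$; (3) there is a family $\mathcal{F}\subseteq J^+$ such that (a) for each $X\in J^+$ there exists a $Y\in\mathcal{F}$ with $Y\subseteq X$, and (b) every descending $\omega$-sequence of sets from $\mathcal{F}$ has nonempty intersection. Multiboard Gale-Stewart game: for cardinals $\lambda\ge 2$, $\kappa\ge 1$ and a set $A\subseteq{}^{\omega}\lambda$, the game ${\sf GS}_{\lambda}(A,\kappa)$ has one inning per $n<\omega$. In inning $n$ player ONE first selects $f_{2n}\in{}^{\kappa}\lambda$, then player TWO responds with $f_{2n+1}\in{}^{\kappa}\lambda$. ONE wins the play $(f_n:n<\omega)$ if there is an $\alpha<\kappa$ with $(f_n(\alpha):n<\omega)\in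 A$; otherwise TWO wins. A game is determined if one of the players has a winning strategy. ${\sf D}(\lambda,\kappa)$ is the statement: for each set $A\subseteq{}^{\omega}\lambda$ the game ${\sf GS}_{\lambda}(A,\kappa)$ is determined. *)

(* Defs.v *)
From mathcomp Require Import all_boot.
From mathcomp Require Import boolp classical_sets functions cardinality.

Set Implicit Arguments.
Unset Strict Implicit.
Unset Printing Implicit Defensive.

Local Open Scope classical_set_scope.
Local Open Scope card_scope.

(* A cardinal is represented by any type of that cardinality; cardinals are
   compared with [card_le] and identified up to [card_eq] on full sets.
   [Card] is transparent but fixes one universe, so that every cardinal in the
   development, bound or quantified, lives in the same universe. *)
Definition Card := Type.

(* A class of cardinals is a predicate [C : Card -> Prop], read as
   {|L| : C L}; a set of cardinals is the range of a family of cardinals indexed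
   by a type of the universe [Card].  A class is proper when it is not a set,
   equivalently (by separation) not included in a set. *)
Definition proper_class (C : Card -> Prop) : Prop :=
  ~ exists (I : Card) (c : I -> Card),
      forall L : Card, C L -> exists i : I, [set: L] #= [set: c i].

Section Ideals.
Variable S : Type.
Implicit Types J F : set (set S).

Definition ideal J : Prop :=
  [/\ J !=set0,
      forall X Y : set S, Y `<=` X -> J X -> J Y
    & forall X Y : set S, J X -> J Y -> J (X `|` Y)].

Definition proper J : Prop := J <> [set: set S].

Definition free J : Prop := \bigcup_(X in J) X = [set: S].

Definition positive J : set (set S) := ~` J.

(* [succ_complete L J] : J is |L|^+-complete. *)
Definition succ_complete (L : Type) J : Prop :=
  forall A : set (set S),
    A `<=` J -> A #<= [set: L] -> J (\bigcup_(X in A) X).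

Definition splits_positive (L : Type) J : Prop :=
  forall X : set S, positive J X ->
    exists P : L -> set S,
      partition [set: L] P X /\ forall i, positive J (P i).

Definition dense_in_positive J F : Prop :=
  forall X : set S, positive J X -> exists2 Y, F Y & Y `<=` X.

Definition sigma_closed F : Prop :=
  forall Y : nat -> set S,
    (forall n, F (Y n)) -> (forall n, Y n.+1 `<=` Y n) ->
    \bigcap_n Y n !=set0.

End Ideals.

(* The principle I(|L|, |K|). *)
Definition I_principle (L K : Card) : Prop :=
  exists J : set (set K),
    [/\ ideal J, proper J & free J] /\
    [/\ succ_complete L J,
        splits_positive L J
      & exists F : set (set K),
          [/\ F `<=` positive J, dense_in_positive J F & sigma_closed F]].

Section MultiboardGame.
Variables L K : Type.

(* A play of GS_|L|(A, |K|): [f n] is the n-th move, made by player ONE when n is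
   even and by player TWO when n is odd; [f n a] is its value on board [a]. *)
Definition play := nat -> K -> L.

Definition ONE_wins (A : set (nat -> L)) (f : play) : Prop :=
  exists a : K, A (fun n => f n a).

(* A strategy maps the finite sequence of all moves made so far to a move. *)
Definition strategy := seq (K -> L) -> (K -> L).

Definition follows_ONE (s : strategy) (f : play) : Prop :=
  forall n, f n.*2 = s (mkseq f n.*2).

Definition follows_TWO (s : strategy) (f : play) : Prop :=
  forall n, f n.*2.+1 = s (mkseq f n.*2.+1).

Definition winning_ONE (A : set (nat -> L)) (s : strategy) : Prop :=
  forall f : play, follows_ONE s f -> ONE_wins A f.

Definition winning_TWO (A : set (nat -> L)) (s : strategy) : Prop :=
  forall f : play, follows_TWO s f -> ~ ONE_wins A f.

Definition determined (A : set (nat -> L)) : Prop :=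
  (exists s, winning_ONE A s) \/ (exists s, winning_TWO A s).

End MultiboardGame.

(* The principle D(|L|, |K|). *)
Definition D_principle (L K : Card) : Prop :=
  forall A : set (nat -> L), determined K A.

(* Main.v *)
Require Import Defs.
From mathcomp Require Import all_boot.
From mathcomp Require Import boolp classical_sets functions cardinality.

Set Implicit Arguments.
Unset Strict Implicit.
Unset Printing Implicit Defensive.

Local Open Scope classical_set_scope.
Local Open Scope card_scope.

(** Let [r : L -> L'] be injective and let [J] witness I(|L'|, |K|); then the
    game on [K] boards is determined for every [A].  Compare it with the
    ordinary game on a single board.

    If TWO has a winning strategy there, TWO follows it separately on each
    board and no board ever ends in [A].

    Otherwise ONE wins by forcing TWO to reveal a whole single-board strategy
    during one play ([determined_of_splitting]).  ONE keeps a tree of positive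
    sets of boards, indexed by the finite sequences of moves of ONE: a positive
    set [X] is cut into disjoint positive pieces, one for each [y : L], and ONE
    plays [y] on the piece with label [y].  Whatever TWO answers, completeness
    of [J] makes the answer constant on a positive part of each piece
    ([positive_fiber]), and density shrinks this part to a member of the family
    [F].  So at every node of the tree TWO has one answer, and these answers
    form a single-board strategy of TWO.  It is not winning: some branch of the
    tree yields a sequence in [A].  The sets along this branch descend in [F],
    hence share a board, on which the play is exactly that sequence.

    It remains to find a member of the proper class into which [L] injects.
    Cardinals are comparable ([injective_total]), so if there were none, each
    member of the class would be equipotent to a subset of [L], and the class
    would be a set. *)

(** * Comparability of cardinals *)

(** A maximal partial matching between [T] and [U] exhausts [T] or [U].
    Encoding an edge [(t, u)] by the two-point set [{inl t, inr u}] of the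
    disjoint sum turns matchings into disjoint families, for which maximal
    ones exist. *)
Lemma injective_total (T U : Type) :
  (exists f : T -> U, injective f) \/ (exists g : U -> T, injective g).
Proof.
pose F (p : T * U) : set (T + U) := [set inl p.1; inr p.2].
have [E [_ Etriv Emax]] := ex_maximal_disjoint_subcollection F setT.
have shared p q c : E p -> E q -> F p c -> F q c -> p = q.
  by move=> Ep Eq pc qc; apply: Etriv => //; exists c.
have [domE|/existsNP[t tE]] := pselect (forall t, exists u, E (t, u)).
  have [f fE] := choice domE; left; exists f => t t' ft.
  have [] // : (t, f t) = (t', f t').
  by apply: (shared _ _ (inr (f t))) => //; right => //=; rewrite ft.
have [codE|/existsNP[u uE]] := pselect (forall u, exists t, E (t, u)).
  have [g gE] := choice codE; right; exists g => u u' gu.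
  have [] // : (g u, u) = (g u', u').
  by apply: (shared _ _ (inl (g u))) => //; left => //=; rewrite gu.
(* [t] and [u] are both unmatched, so the edge [(t, u)] contradicts
   maximality. *)
exfalso; apply: (Emax (E `|` [set (t, u)])) => //.
  split=> [p Ep|sub]; first by left.
  by apply: tE; exists u; apply: sub; right.
have fresh p c : E p -> F p c -> F (t, u) c -> False.
  case: p => t' u' Ep [] -> [] //.
    by move=> [tt']; apply: tE; exists u'; rewrite -tt'.
  by move=> [uu']; apply: uE; exists t'; rewrite -uu'.
move=> p q [Ep|->] [Eq|->] [c [pc qc]] //.
- exact: shared pc qc.
- by case: (fresh p c).
- by case: (fresh q c).
Qed.

Lemma injective_card_le (T U : Type) (f : T -> U) :
  injective f -> [set: T] #<= [set: U].
Proof.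
move=> finj; have [g] : $|{injfun [set: T] >-> [set: U]}|.
  by apply/injfunPex; exists f => // x y _ _; exact: finj.
exact: inj_card_le g.
Qed.

Lemma injective_card_range (T U : Type) (f : T -> U) :
  injective f -> [set: T] #= [set: {u : U | range f u}].
Proof.
move=> finj.
pose g t : {u : U | range f u} := exist _ (f t) (imageT f t).
have ginj : injective g by move=> x y [] /finj.
have -> : [set: {u : U | range f u}] = range g.
  apply/seteqP; split=> // -[u fu] _.
  by have [t _ ft] := fu; exists t => //; exact: eq_exist.
by rewrite card_eq_sym; apply: inj_card_eq => x y _ _; exact: ginj.
Qed.

Lemma proper_class_unbounded (C : Card -> Prop) :
  proper_class C -> forall L : Card,
  exists2 L' : Card, C L' & exists r : L -> L', injective r.
Proof.
move=> Cproper L; apply: contrapT => noL'; apply: Cproper.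
exists (L -> Prop), (fun X : L -> Prop => {x : L | X x}) => L' CL'.
have [rinj|[g ginj]] := injective_total L L'; first by case: noL'; exists L'.
by exists (range g); exact: injective_card_range.
Qed.

(** * Positive sets of an ideal *)

Lemma positive_setT (S : Type) (J : set (set S)) :
  ideal J -> Defs.proper J -> positive J [set: S].
Proof.
move=> [_ Jsub _] Jproper JT; apply: Jproper; apply/seteqP; split=> // X _.
exact: Jsub JT.
Qed.

Lemma positive_fiber (S L L' : Type) (J : set (set S)) (r : L -> L')
    (X : set S) (g : S -> L) :
  ideal J -> succ_complete L' J -> injective r -> positive J X ->
  exists y, positive J (X `&` g @^-1` [set y]).
Proof.
move=> [_ Jsub _] Jcomplete rinj Xpos; apply: contrapT => nofiber; apply: Xpos.
pose fiber y := X `&` g @^-1` [set y].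
apply: (Jsub (\bigcup_(Y in range fiber) Y)) => [a Xa|].
  by exists (fiber (g a)) => //; exists (g a).
apply: Jcomplete => [_ [y _ <-]|].
  by apply: contrapT => ypos; apply: nofiber; exists y.
apply: (card_le_trans (card_image_le fiber setT)).
exact: injective_card_le rinj.
Qed.

Lemma splits_positive_inj (S L L' : Type) (J : set (set S)) (r : L -> L')
    (X : set S) :
  injective r -> splits_positive L' J -> positive J X ->
  exists P : L -> set S,
    [/\ forall y, positive J (P y), forall y, P y `<=` X
      & trivIset [set: L] P].
Proof.
move=> rinj Jsplit /Jsplit[P [[Pcover Ptriv _] Ppos]].
exists (P \o r); split=> [y|y|y z _ _ /=]; first exact: Ppos.
- by rewrite -Pcover => a Pa; exists (r y).
- by move/(Ptriv _ _ I I)/rinj.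
Qed.

(** * The tree of positive sets *)

Section Tree.
Variables (L K : Type).
Variables (piece : set K -> L -> set K) (shrink : set K -> (K -> L) -> set K).

(** The node reached after [n] innings when TWO plays [g].  The selector [p] of
    moves of ONE may look at the current node, so that the same recursion
    describes both a prescribed branch ([p] ignores its set argument) and the
    branch that a given board follows ([p] reads off the label of the board). *)
Fixpoint node (g : nat -> K -> L) (p : nat -> set K -> L) (n : nat) : set K :=
  if n is m.+1 then
    let X := node g p m in shrink (piece X (p m X)) (g m)
  else setT.

(** The first [n] innings determine the node: this makes the strategies below
    depend on the past only. *)
Lemma eq_node g g' p p' n :
  (forall m, m < n -> g m = g' m) -> (forall m, m < n -> p m = p' m) ->
  node g p n = node g' p' n.
Proof.
elim: n => //= n IHn gg' pp'.
rewrite IHn => [|m mn|m mn]; first by rewrite gg' // pp'.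
- by apply: gg'; exact: ltnW.
- by apply: pp'; exact: ltnW.
Qed.

(** A board whose labels agree with a branch follows that branch: this is how
    the boardwise definition of the strategy of ONE is matched with the tree. *)
Lemma node_label g (label : set K -> K -> L) (x : nat -> L) a n :
  (forall m, m < n ->
     label (node g (fun k _ => x k) m) a = x m) ->
  node g (fun _ X => label X a) n = node g (fun k _ => x k) n.
Proof.
elim: n => //= n IHn xa; rewrite IHn => [|m mn]; last by apply: xa; exact: ltnW.
by rewrite xa.
Qed.

End Tree.

(** * Determinacy *)

(** [N] is the family of sets of boards that ONE can keep splitting, [F] the
    part of it in which descending sequences have a common board.  Either TWO
    copies a winning single-board strategy on all boards, or the answers
    of TWO at the nodes of the tree form a losing single-board strategy, which
    ONE defeats along a branch. *)
Lemma determined_of_splitting (L K : Type) (l0 : L) (N F : set (set K)) :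
  N setT -> F `<=` N -> sigma_closed F ->
  (forall X, N X -> exists P : L -> set K,
     [/\ forall y, N (P y), forall y, P y `<=` X & trivIset [set: L] P]) ->
  (forall X (g : K -> L), N X ->
     exists Y y, [/\ F Y, Y `<=` X & Y `<=` g @^-1` [set y]]) ->
  D_principle L K.
Proof.
move=> NT FN Fclosed Nsplit Nhom A.
have [[tau tauwin]|notau] := pselect (exists tau : seq L -> L,
    forall z : nat -> L,
      (forall n, z n.*2.+1 = tau (mkseq z n.*2.+1)) -> ~ A z).
  right; exists (fun h a => tau [seq u a | u <- h]) => f foll [a Afa].
  apply: (tauwin _ _ Afa) => n.
  by rewrite foll /mkseq -map_comp.
left.
have /choice[piece pieceP] : forall X, exists P : L -> set K,
    N X -> [/\ forall y, N (P y), forall y, P y `<=` X & trivIset [set: L] P].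
  move=> X; have [NX|nNX] := pselect (N X); last by exists (fun=> set0).
  by have [P] := Nsplit X NX; exists P.
have /choice[hom homP] : forall Xg : set K * (K -> L), exists Yy : set K * L,
    N Xg.1 -> [/\ F Yy.1, Yy.1 `<=` Xg.1 & Yy.1 `<=` Xg.2 @^-1` [set Yy.2]].
  case=> X g; have [NX|nNX] := pselect (N X); last by exists (set0, l0).
  by have [Y [y Yy]] := Nhom X g NX; exists (Y, y).
have /choice[lab labP] : forall Xa : set K * K, exists y : L,
    (exists z, piece Xa.1 z Xa.2) -> piece Xa.1 y Xa.2.
  move=> Xa; have [[z az]|] := pselect (exists z, piece Xa.1 z Xa.2).
    by exists z.
  by exists l0.
pose shrink X g := (hom (X, g)).1; pose reply X g := (hom (X, g)).2.
have shrinkP X g : N X ->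
    [/\ F (shrink X g), shrink X g `<=` X
      & shrink X g `<=` g @^-1` [set reply X g]] by exact: (homP (X, g)).
have pieceN X y : N X -> N (piece X y) by case/pieceP.
pose label X a := lab (X, a).
(* [move_of h k] is the answer of TWO in inning [k].  Board [a] computes its own
   node from these answers and ONE plays the label of its piece there; a board
   outside all pieces gets an arbitrary label and lies in no later node. *)
pose move_of (h : seq (K -> L)) k := nth (fun=> l0) h k.*2.+1.
pose s (h : seq (K -> L)) a :=
  label (node piece shrink (move_of h) (fun _ X => label X a) (size h)./2) a.
exists s => f foll.
pose g k := f k.*2.+1.
pose T (x : nat -> L) := node piece shrink g (fun k _ => x k).
have TS x n : T x n.+1 = shrink (piece (T x n) (x n)) (g n) by [].
have TN x n : N (T x n).
  elim: n => // n IHn; rewrite TS; apply: FN.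
  by case: (shrinkP _ (g n) (pieceN _ (x n) IHn)).
have TpieceN x n : N (piece (T x n) (x n)) by exact: pieceN.
have TF x n : F (T x n.+1) by case: (shrinkP _ (g n) (TpieceN x n)).
have Tpiece x n : T x n.+1 `<=` piece (T x n) (x n).
  by case: (shrinkP _ (g n) (TpieceN x n)).
have Tdec x n : T x n.+1 `<=` T x n.
  move=> a /Tpiece; case: (pieceP _ (TN x n)) => _ + _; exact.
have label_piece X y a : N X -> piece X y a -> label X a = y.
  move=> /pieceP[_ _ Xtriv] ay; apply: Xtriv => //; exists a; split=> //.
  by apply: (labP (X, a)); exists y.
(* The single-board strategy of TWO that the play [f] reveals; it reads the
   moves of ONE at the even positions of the history. *)
pose tau (l : seq L) :=
  let x k := nth l0 l k.*2 in let n := (size l)./2 in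
  reply (piece (T x n) (x n)) (g n).
have /existsNP[z /not_implyP[ztau /contrapT Az]] :
    ~ forall z : nat -> L,
      (forall n, z n.*2.+1 = tau (mkseq z n.*2.+1)) -> ~ A z.
  by move=> tauwin; apply: notau; exists tau.
pose x k := z k.*2.
(* The nodes are shifted by one because the root need not be in [F]. *)
have [a aT] : \bigcap_n T x n.+1 !=set0.
  by apply: Fclosed => n; [exact: TF | exact: Tdec].
have ax n : label (T x n) a = x n by apply/label_piece/Tpiece/aT.
exists a; suff -> : (fun n => f n a) = z by [].
apply/funext => n; rewrite -(odd_double_half n); set m := n./2.
case: (odd n); rewrite ?add1n ?add0n.
- have -> : z m.*2.+1 = reply (piece (T x m) (x m)) (g m).
    rewrite ztau /tau size_mkseq /= uphalf_double.
    have -> : T (fun k => nth l0 (mkseq z m.*2.+1) k.*2) m = T x m.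
      apply: eq_node => // k km; rewrite nth_mkseq // ltnS leq_double.
      exact: ltnW.
    by rewrite nth_mkseq.
  by have [_ _] := shrinkP _ (g m) (TpieceN x m); apply; exact: aT.
- rewrite foll /s size_mkseq doubleK -[RHS]ax; congr label.
  rewrite /T -(node_label (label := label) (a := a));
    last by move=> k _; exact: ax.
  apply: eq_node => // k km.
  by rewrite /move_of nth_mkseq // ltn_Sdouble.
Qed.

(** The move set [L] may be smaller than the cardinal [L'] of the ideal
    principle: only the pieces with index in the image of [L] are used, and
    the boards outside them are given up. *)
Lemma I_principle_determined (L L' K : Card) (l0 : L) (r : L -> L') :
  injective r -> I_principle L' K -> D_principle L K.
Proof.
move=> rinj [J [[Jideal Jproper _]]].
move=> [Jcomplete Jsplit [F [Fpos Fdense Fclosed]]].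
apply: (determined_of_splitting l0 (N := positive J) (F := F)) => //.
- exact: positive_setT.
- by move=> X; exact: splits_positive_inj rinj Jsplit.
- move=> X g Xpos.
  have [y /Fdense[Y FY YX]] := positive_fiber g Jideal Jcomplete rinj Xpos.
  by exists Y, y; split=> // a /YX[].
Qed.

Lemma infinite_inhabited (K : Type) : infinite_set [set: K] -> inhabited K.
Proof.
move=> Kinf; apply: contrapT => Kempty; apply: Kinf.
suff -> : [set: K] = set0 by exact: finite_set0.
by apply/seteqP; split=> // k _; case: Kempty.
Qed.

Theorem lemma24 :
  (exists C : Card -> Prop,
      proper_class C /\
      (forall L : Card, C L -> infinite_set [set: L]) /\
      (forall L : Card, C L ->
         exists K : Card, infinite_set [set: K] /\ I_principle L K)) ->
  forall L : Card, `I_2 #<= [set: L] ->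
  exists K : Card, `I_1 #<= [set: K] /\ D_principle L K.
Proof.
move=> [C [Cproper [_ CI]]] L /card_leP[i].
have two0 : `I_2 0 by [].
have [l0 _] := i (SigSub (mem_set two0)).
have [L' CL' [r rinj]] := proper_class_unbounded Cproper L.
have [K [/infinite_inhabited[k] IK]] := CI L' CL'.
exists K; split; last exact: I_principle_determined rinj IK.
have [c] : $|{injfun `I_1 >-> [set: K]}|; last exact: inj_card_le c.
apply/injfunPex; exists (fun=> k) => // m n /set_mem + /set_mem.
by case: m n => [|m] [|n].
Qed.
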